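(* Let $\mathcal V$ be a variety of algebras. The following conditions on $\mathcal V$ are equivalent. (i) $R \subseteq Cg([R,R|1])$ for every algebra $\mathbf A\in\mathcal V$ and every reflexive compatible relation $R$ on $\mathbf A$. (ia) $R^* \subseteq Cg([R,R|1])$ for every algebra $\mathbf A\in\mathcal V$ and every reflexive compatible relation $R$ on $\mathbf A$. (ii) $R\cap T \subseteq Cg([R,T|1])$ for every algebra $\mathbf A\in\mathcal V$ and all reflexive compatible relations $R,T$ on $\mathbf A$. (iii) $(R_1\circ R_2)\cap T \subseteq Cg\big(T\cap (R_2^-\circ (T\cap (R_1^-\circ R_1))\circ R_2)\big)$ for every algebra $\mathbf A\in\mathcal V$ and all reflexive compatible relations $R_1,R_2,T$ on $\mathbf A$. (iv) $R_1\cap (T\circ R_2) \subseteq Cg\big(T\cap (R_2\circ (T\cap (R_1^-\circ R_1))\circ R_2^-)\big)\circ R_2$ for every algebra $\mathbf A\in\mathcal V$ and all reflexive compatible relations $R_1,R_2,T$ on $\mathbf A$. (v) $\beta\cap (T\circ S) \subseteq Cg\big(T\cap (S\circ (T\cap\beta)\circ S)\big)\circ S$ for every algebra $\mathbf A\in\mathcal V$ and every congruence $\beta$, tolerance $S$ and reflexive compatible relation $T$ on $\mathbf A$. (vi) $\beta\cap (T\circ\gamma) \subseteq Cg(\gamma\circ (T\cap\beta))$ for every algebra $\mathbf A\in\mathcal V$, all congruences $\beta,\gamma$ and every reflexive compatible relation $T$ on $\mathbf A$. (vii)$'$ For some even integer $n\ge 0$, $\mathcal V$ has $4$-ary terms $f_0,\dots,f_n$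 such that the following identities hold in $\mathcal V$: $$x=f_0(x,y,z,x),\qquad f_n(x,y,z,y)=z,$$ $$f_i(x,y,x,x)=f_i(x,y,x,y)\quad\text{for } i \text{ even},\ 0\le i\le n,$$ $$f_{i-1}(x,y,y,y)=f_i(x,y,y,y)\quad\text{for } i \text{ odd},\ 1\le i\le n,$$ $$f_i(x,y,x,y)=f_i(x,y,x,x)\quad\text{for } i \text{ odd},\ 0\le i\le n,$$ $$f_{i-1}(x,y,y,x)=f_i(x,y,y,x)\quad\text{for } i \text{ even},\ 1\le i\le n.$$ (viii) For every integer $n\ge 2$, $$(R_1\circ R_2\circ\cdots\circ R_{n-1}\circ R_n)\cap T \subseteq Cg\big(T\cap (R_n^-\circ (T\cap (R_{n-1}^-\circ\cdots (T\cap (R_2^-\circ (T\cap (R_1^-\circ R_1))\circ R_2))\cdots\circ R_{n-1}))\circ R_n)\big)$$ for every algebra $\mathbf A\in\mathcal V$ and all reflexive compatible relations $R_1,\dots,R_n$ and $T$ on $\mathbf A$. (That is, the right-hand side is $Cg(D_n)$, where $D_1=T\cap(R_1^-\circ R_1)$ and $D_{i+1}=T\cap(R_{i+1}^-\circ D_i\circ R_{i+1})$.)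
   Context: A variety is a class of algebras of a fixed signature defined by identities. A relation on an algebra $\mathbf A$ means a binary relation on its universe; it is compatible (also called admissible) if it is a subalgebra of $\mathbf A\times\mathbf A$. A tolerance is a reflexive, symmetric, compatible relation; a congruence is a transitive tolerance. $R\circ S$ denotes relational composition: $x\,(R\circ S)\,y$ iff there is $z$ with $x\,R\,z$ and $z\,S\,y$. $R^-$ is the converse of $R$; $R^*$ is the transitive closure of $R$; $Cg(R)$ is the smallest congruence of $\mathbf A$ containing $R$. For reflexive compatible relations $R,S$ on $\mathbf A$, $M(R,S)$ is the set of all matrices $$\begin{vmatrix} t(\bar a,\bar b) & t(\bar a,\bar b')\\ t(\bar a',\bar b) & t(\bar a',\bar b')\end{vmatrix}$$ where $t$ is a term (of any arity $h+k$), $\bar a,\bar a'\in A^h$ and $\bar b,\bar b'\in A^k$ satisfy $a_j\,R\,a'_j$ for all $j\le h$ and $b_j\,S\,b'_j$ for all $j\le k$. $[R,S|1]$ is the transitive closure of the set $$\left\{(z,w)\ \Big|\ \begin{vmatrix} x & x\\ z & w\end{vmatrix}\in M(R,S)\text{ for some } x\in A\right\}.$$ *)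

(* Defs.v *)
From Stdlib Require Import Relations RelationClasses.
From mathcomp Require Import all_boot.

Set Implicit Arguments.
Unset Strict Implicit.
Unset Printing Implicit Defensive.

Record signature := Signature { symb : Type; arity : symb -> nat }.

Record algebra (sg : signature) := Algebra {
  carrier :> Type;
  interp : forall o : symb sg, ('I_(arity o) -> carrier) -> carrier }.

Inductive term (sg : signature) (X : Type) : Type :=
| Var of X
| App (o : symb sg) of 'I_(arity o) -> term sg X.

Fixpoint eval (sg : signature) (A : algebra sg) (X : Type) (env : X -> A)
    (t : term sg X) : A :=
  match t with
  | Var x => env x
  | App o args => interp (fun i => eval env (args i))
  end.

Definition satisfies (sg : signature) (A : algebra sg)
    (p q : term sg nat) : Prop :=
  forall env : nat -> A, eval env p = eval env q.

Definition variety (sg : signature) (V : algebra sg -> Prop) : Prop :=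
  exists E : term sg nat -> term sg nat -> Prop,
    forall A : algebra sg, V A <-> (forall p q, E p q -> satisfies A p q).

Definition app4 (sg : signature) (A : algebra sg) (f : term sg 'I_4)
    (x y z w : A) : A :=
  eval (tnth [tuple x; y; z; w]) f.

Section Relations.

Variable A : Type.
Implicit Types R S : relation A.

Definition rcomp R S : relation A := fun x y => exists z, R x z /\ S z y.

Definition rmeet R S : relation A := fun x y => R x y /\ S x y.

End Relations.

Declare Scope relalg_scope.
Delimit Scope relalg_scope with relalg.

Notation "R ∘ S" := (rcomp R S)
  (at level 40, left associativity) : relalg_scope.
Notation "R ∩ S" := (rmeet R S)
  (at level 48, left associativity) : relalg_scope.
Notation "R ⊆ S" := (inclusion _ R S)
  (at level 70, no associativity) : relalg_scope.
Notation "R ⁻" := (transp _ R)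
  (at level 1, left associativity, format "R ⁻") : relalg_scope.
Notation "R ^*" := (clos_trans _ R) : relalg_scope.

Local Open Scope relalg_scope.

Section AlgebraRelations.

Variables (sg : signature) (A : algebra sg).
Implicit Types R S T : relation A.

Definition compatible R : Prop :=
  forall (o : symb sg) (a b : 'I_(arity o) -> A),
    (forall i, R (a i) (b i)) -> R (interp a) (interp b).

Definition refl_compatible R : Prop := Reflexive R /\ compatible R.

Definition tolerance R : Prop := refl_compatible R /\ Symmetric R.

Definition congruence R : Prop := tolerance R /\ Transitive R.

Definition Cg R : relation A :=
  fun x y => forall theta : relation A, congruence theta -> R ⊆ theta ->
    theta x y.

(* [M R S p q r s] says that the 2x2 matrix with first row (p, q) and second
   row (r, s) belongs to M(R, S). The h + k variables of the term t are
   indexed by the disjoint sum 'I_h + 'I_k. *)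
Definition M R S (p q r s : A) : Prop :=
  exists (h k : nat) (t : term sg ('I_h + 'I_k))
         (a a' : 'I_h -> A) (b b' : 'I_k -> A),
    let ev (u : 'I_h -> A) (v : 'I_k -> A) : A :=
      eval (fun j => match j with inl i => u i | inr i => v i end) t in
    [/\ forall j, R (a j) (a' j),
        forall j, S (b j) (b' j),
        p = ev a b /\ q = ev a b' &
        r = ev a' b /\ s = ev a' b'].

(* The relation written [R, S | 1]. *)
Definition comm1 R S : relation A :=
  (fun z w => exists x : A, M R S x x z w)^*.

(* D_1 = T ∩ (R_1⁻ ∘ R_1) and D_(i+1) = T ∩ (R_(i+1)⁻ ∘ D_i ∘ R_(i+1)).
   Only the indices n >= 1 are meaningful; the value at 0 is never used. *)
Fixpoint D (Rs : nat -> relation A) T (n : nat) : relation A :=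
  match n with
  | 0 => eq
  | 1 => T ∩ ((Rs 1)⁻ ∘ Rs 1)
  | (m.+1) as i => T ∩ ((Rs i)⁻ ∘ D Rs T m ∘ Rs i)
  end.

End AlgebraRelations.

(* Main.v *)
Require Import Defs.
From Stdlib Require Import Relations RelationClasses.
From Stdlib Require Import FunctionalExtensionality PropExtensionality.
From Stdlib Require Import ProofIrrelevance ClassicalEpsilon.
From HB Require Import structures.
From mathcomp Require Import all_boot.

Set Implicit Arguments.
Unset Strict Implicit.
Unset Printing Implicit Defensive.

Local Open Scope relalg_scope.

(** All the conditions say that commutators detect every relation, and they turn
    around a single family of terms.

    From commutators to inclusions. A matrix of [M (R1 ∘ ... ∘ Rn) T] whose first
    row is [(x, x)] can be cut into [n] layers by evaluating its term at the
    intermediate arguments. Every row of the cut matrix is [T]-related, the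
    columns of the layer [i] are [Ri]-related, and the two entries of the row
    after the first layer are both [R1]-related to [x]. Hence the last row lies
    in the nested relation [D Rs T n] ([M_big_D]), so (ii) gives (viii), of which
    (iii) is the case [n = 2]. Then (iv) is (iii) for the converse of [R2], (v)
    is a special case of (iv), and (vi) only enlarges the congruence in (v).

    From inclusions to terms. In the free algebra on [x, y, z] take for [beta]
    and [gamma] the congruences identifying [x] with [z], and [y] with [z], and
    for [T] the relation generated by the pair [(x, y)]. Since
    [x T y gamma z] and [x beta z], condition (vi) joins [x] to [z] by a chain
    of steps in [P := T ∩ beta], in [gamma] and in the converse of [P]
    ([Cg_rcomp_zigzag]). A step in [T] is a 4-ary term [f] evaluated at
    [(x, y, z, x)] and at [(x, y, z, y)], and membership in [beta] or [gamma] is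
    an identity with two variables equated; the chain is therefore exactly a
    sequence of terms as in (vii)' ([zigzag_terms_exist]).

    From terms to commutators. For [a R b], the matrix with entries
    [f_i(a, b, {a, b}, {a, b})] has a constant first row by the identities at
    [(x, y, x)], so its second row is in the commutator; the identities at
    [(x, y, y)] link these second rows for successive [i] into a chain from [a]
    to [b] ([zigzag_terms_neutral]). This is (i), from which (ia), (ii) and so
    (viii) follow. *)

(** * The monoid of binary relations *)

Lemma relation_ext (A : Type) (R S : relation A) :
  (forall x y, R x y <-> S x y) -> R = S.
Proof.
move=> eqRS; apply: functional_extensionality => x.
apply: functional_extensionality => y.
exact: propositional_extensionality.
Qed.

Lemma rcompA (A : Type) : associative (@rcomp A).
Proof.
move=> R S T; apply: relation_ext => x y; split.
  by case=> u [Rxu [v [Suv Tvy]]]; exists v; split=> //; exists u.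
by case=> v [[u [Rxu Suv]] Tvy]; exists u; split=> //; exists v.
Qed.

Lemma rcomp_eql (A : Type) : left_id eq (@rcomp A).
Proof.
move=> R; apply: relation_ext => x y; split=> [[u [-> //]]|Rxy].
by exists x.
Qed.

Lemma rcomp_eqr (A : Type) : right_id eq (@rcomp A).
Proof.
move=> R; apply: relation_ext => x y; split=> [[u [Rxu <- //]]|Rxy].
by exists y.
Qed.

HB.instance Definition _ (A : Type) :=
  Monoid.isLaw.Build (relation A) eq (@rcomp A)
    (@rcompA A) (@rcomp_eql A) (@rcomp_eqr A).

Lemma clos_trans_min (A : Type) (R S : relation A) :
  Transitive S -> R ⊆ S -> R^* ⊆ S.
Proof.
by move=> trS subRS x y; elim=> [u v /subRS //|u v w _ Suv _]; apply: trS.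
Qed.

Lemma clos_trans_mono (A : Type) (R S : relation A) : R ⊆ S -> R^* ⊆ S^*.
Proof.
move=> subRS; apply: clos_trans_min => [x y z|x y Rxy]; first exact: t_trans.
exact/t_step/subRS.
Qed.

Definition rpow (A : Type) (R : relation A) (n : nat) : relation A :=
  iter n (rcomp R) eq.

Lemma rpowD (A : Type) (R : relation A) m n :
  rpow R (m + n) = rpow R m ∘ rpow R n.
Proof.
elim: m => [|m IHm]; first by rewrite add0n [RHS]rcomp_eql.
by rewrite addSn /rpow !iterS -!/(rpow _ _) IHm rcompA.
Qed.

Lemma rpow_refl (A : Type) (R : relation A) n :
  Reflexive R -> Reflexive (rpow R n).
Proof. by move=> rR x; elim: n => //= n IHn; exists x. Qed.

Lemma rpow_leq (A : Type) (R : relation A) m n :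
  Reflexive R -> m <= n -> rpow R m ⊆ rpow R n.
Proof.
move=> rR le_mn x y Rxy; rewrite -(subnKC le_mn) rpowD.
by exists y; split=> //; apply: rpow_refl.
Qed.

(** * Compatible relations and generated congruences *)

Section Compatible.

Variables (sg : signature) (A : algebra sg).
Implicit Types R S T P : relation A.

Lemma eval_ext (X : Type) (e e' : X -> A) (t : term sg X) :
  e =1 e' -> eval e t = eval e' t.
Proof. by move=> /functional_extensionality ->. Qed.

Lemma compatible_eval R (X : Type) (e e' : X -> A) (t : term sg X) :
  compatible R -> (forall x, R (e x) (e' x)) -> R (eval e t) (eval e' t).
Proof. by move=> cR Re; elim: t => [x|o ts IH] /=; [apply: Re | apply: cR]. Qed.

Lemma refl_compatible_meet R S :
  refl_compatible R -> refl_compatible S -> refl_compatible (R ∩ S).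
Proof.
move=> [rR cR] [rS cS]; split=> [x|o a b RSab]; first by split.
by split; [apply: cR | apply: cS] => i; case: (RSab i).
Qed.

Lemma refl_compatible_rcomp R S :
  refl_compatible R -> refl_compatible S -> refl_compatible (R ∘ S).
Proof.
move=> [rR cR] [rS cS]; split=> [x|o a b]; first by exists x.
case/fin_all_exists=> c RSc; exists (interp c).
by split; [apply: cR | apply: cS] => i; case: (RSc i).
Qed.

Lemma refl_compatible_transp R : refl_compatible R -> refl_compatible (R⁻).
Proof. by move=> [rR cR]; split=> [x|o a b Rba]; [apply: rR | apply: cR]. Qed.

Lemma refl_compatible_eq : refl_compatible (@eq A).
Proof. by split=> [x //|o a b /functional_extensionality ->]. Qed.

Lemma refl_compatible_rpow R n : refl_compatible R -> refl_compatible (rpow R n).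
Proof.
move=> rcR; elim: n => [|n IHn]; first exact: refl_compatible_eq.
exact: refl_compatible_rcomp.
Qed.

Lemma Cg_sub R : R ⊆ Cg R.
Proof. by move=> x y Rxy theta _; apply. Qed.

Lemma Cg_min R theta : congruence theta -> R ⊆ theta -> Cg R ⊆ theta.
Proof. by move=> cg sub x y; apply. Qed.

Lemma Cg_congruence R : congruence (Cg R).
Proof.
split; [split; [split|]|].
- by move=> x theta [[[r _] _] _] _; apply: r.
- move=> o a b Rab theta cg sub; case: (cg) => [[[_ c] _] _].
  by apply: c => i; apply: Rab.
- by move=> x y Rxy theta cg sub; case: (cg) => [[_ s] _]; exact: s (Rxy theta cg sub).
- move=> x y z Rxy Ryz theta cg sub; case: (cg) => [_ t].
  by apply: t; [apply: Rxy | apply: Ryz].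
Qed.

Lemma Cg_mono R S : R ⊆ S -> Cg R ⊆ Cg S.
Proof.
move=> sub; apply: Cg_min; first exact: Cg_congruence.
by move=> x y /sub; apply: Cg_sub.
Qed.

(** The hard point is compatibility: the chains joining the different pairs of
    arguments have different lengths, but there are finitely many of them and
    reflexivity lets all be padded to the longest one. *)
Lemma rpow_congruence R m :
  refl_compatible R -> R⁻ ⊆ rpow R m ->
  congruence (fun x y => exists n, rpow R n x y).
Proof.
move=> rcR conv; have [rR _] := rcR.
split; [split; [split|]|].
- by move=> x; exists 0.
- move=> o a b /fin_all_exists[n Rn]; exists (\max_i n i).
  have [_ cpow] := refl_compatible_rpow (\max_i n i) rcR.
  by apply: cpow => i; apply: rpow_leq (Rn i) => //; apply: leq_bigmax.
- move=> x y [n]; elim: n x => [x ->|n IHn x [u [Rxu Ruy]]]; first by exists 0.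
  have [k Ryu] := IHn _ Ruy; exists (k + m); rewrite rpowD.
  by exists u; split=> //; apply: conv.
- by move=> x y z [m' Rxy] [n Ryz]; exists (m' + n); rewrite rpowD; exists y.
Qed.

(** Each factor of [γ ∘ P] and of the converse [γ ∘ P ∘ γ ∘ P⁻] is below
    [P ∘ γ ∘ P⁻ ∘ γ], so the powers of the latter form a congruence. Keeping
    this fixed order of factors is what produces terms whose identities
    alternate with the parity of the index. *)
Lemma Cg_rcomp_zigzag P gamma :
  refl_compatible P -> congruence gamma ->
  Cg (gamma ∘ P) ⊆ (fun x y => exists n, rpow (P ∘ gamma ∘ P⁻ ∘ gamma) n x y).
Proof.
move=> rcP [[rcg sg_] tg]; have [rP _] := rcP; have [rg _] := rcg.
set L := P ∘ gamma ∘ P⁻ ∘ gamma.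
have Lg x y : gamma x y -> L x y.
  by move=> gxy; exists x; split=> //; exists x; split=> //; exists x; split.
have LPgP u v w z : P u v -> gamma v w -> P z w -> L u z.
  move=> Puv gvw Pzw; exists z; split=> //; exists w; split=> //.
  by exists v; split.
have rcL : refl_compatible L.
  apply: refl_compatible_rcomp => //.
  apply: refl_compatible_rcomp; first exact: refl_compatible_rcomp.
  exact: refl_compatible_transp.
apply: Cg_min.
  apply: (@rpow_congruence _ 2) => // y x [w [[v [[u [Pxu guv]] Pwv]] gwy]].
  exists w; split; first exact/Lg/sg_.
  exists x; split=> //; apply: LPgP Pwv _ Pxu; exact: sg_.
move=> x y [u [gxu Puy]]; exists 2; exists u; split; first exact: Lg.
by exists y; split=> //; apply: LPgP Puy _ (rP y).
Qed.

(** * Matrices with constant first row *)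

Lemma M_mono R R' S S' p q r s :
  R ⊆ R' -> S ⊆ S' -> M R S p q r s -> M R' S' p q r s.
Proof.
move=> subR subS [h [k [t [a [a' [b [b' [Ra Sb e1 e2]]]]]]]].
exists h, k, t, a, a', b, b'; split=> // j; [exact/subR | exact/subS].
Qed.

Lemma comm1_mono R R' S S' :
  R ⊆ R' -> S ⊆ S' -> comm1 R S ⊆ comm1 R' S'.
Proof.
move=> subR subS; apply: clos_trans_mono => z w [x Mx].
by exists x; apply: M_mono Mx.
Qed.

Lemma M_row2 R T p q r s :
  refl_compatible T -> M R T p q r s -> T r s.
Proof.
move=> [rT cT] [h [k [t [a [a' [b [b' [Ra Tb _ [-> ->]]]]]]]]].
by apply: compatible_eval => // -[].
Qed.

Lemma M_cols R T p q r s :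
  refl_compatible R -> M R T p q r s -> R p r /\ R q s.
Proof.
move=> [rR cR] [h [k [t [a [a' [b [b' [Ra Tb [-> ->] [-> ->]]]]]]]]].
by split; apply: compatible_eval => // -[].
Qed.

(** A matrix for [R ∘ S] is a matrix for [R] on top of a matrix for [S]: choose
    the intermediate arguments and evaluate the same term there. *)
Lemma M_rcomp R S T p q r s :
  refl_compatible S -> M (R ∘ S) T p q r s ->
  exists r' s', [/\ M R T p q r' s', S r' r & S s' s].
Proof.
move=> [rS cS] [h [k [t [a [a' [b [b' [RSa Tb e1 [-> ->]]]]]]]]].
have [c Rc] := fin_all_exists RSa.
pose ev (u : _ -> A) (v : _ -> A) := eval (fun j : 'I_h + 'I_k =>
  match j with inl i => u i | inr i => v i end) t.
exists (ev c b), (ev c b'); split; last 2 first.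
- by apply: compatible_eval => // -[i|i] //; case: (Rc i).
- by apply: compatible_eval => // -[i|i] //; case: (Rc i).
exists h, k, t, a, c, b, b'; split=> // j; by case: (Rc j).
Qed.

(** Peeling off the factors of the composition one row at a time turns a matrix
    with constant first row into the nested relation [D]: the two entries of
    each row stay [T]-related, and the topmost step leaves a single point, hence
    the innermost [R_1⁻ ∘ R_1]. *)
Lemma M_big_D (Rs : nat -> relation A) T n x z w :
  (forall i, 1 <= i <= n.+1 -> refl_compatible (Rs i)) -> refl_compatible T ->
  M (\big[@rcomp A/eq]_(1 <= i < n.+2) Rs i) T x x z w -> D Rs T n.+1 z w.
Proof.
move=> rcRs rcT; elim: n z w rcRs => [|n IHn] z w rcRs Mx.
  split; first exact: M_row2 Mx.
  have [] := M_cols _ Mx; rewrite big_nat1; first exact: rcRs.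
  by exists x.
split; first exact: M_row2 Mx.
move: Mx; rewrite big_nat_recr //= => /M_rcomp[|z1 [w1 [Mx Sz Sw]]].
  by apply: rcRs; rewrite leqnn.
exists w1; split=> //; exists z1; split=> //; apply: IHn => // i /andP[i1 le_in].
by apply: rcRs; rewrite i1 leqW.
Qed.

Lemma comm1_big_Cg_D (Rs : nat -> relation A) T n :
  (forall i, 1 <= i <= n.+1 -> refl_compatible (Rs i)) -> refl_compatible T ->
  comm1 (\big[@rcomp A/eq]_(1 <= i < n.+2) Rs i) T ⊆ Cg (D Rs T n.+1).
Proof.
move=> rcRs rcT; apply: clos_trans_min; first by case: (Cg_congruence (D Rs T n.+1)).
by move=> z w [x /(M_big_D rcRs rcT)]; apply: Cg_sub.
Qed.

Lemma refl_compatible_big (Rs : nat -> relation A) n :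
  (forall i, 1 <= i <= n -> refl_compatible (Rs i)) ->
  refl_compatible (\big[@rcomp A/eq]_(1 <= i < n.+1) Rs i).
Proof.
move=> rcRs; rewrite big_nat.
elim/big_ind: _ => [|R S|i]; first exact: refl_compatible_eq.
  exact: refl_compatible_rcomp.
exact: rcRs.
Qed.

End Compatible.

(** * Substitution and free algebras *)

Fixpoint bind (sg : signature) (X Y : Type) (s : X -> term sg Y)
    (t : term sg X) : term sg Y :=
  match t with
  | Var x => s x
  | App o ts => App (fun i => bind s (ts i))
  end.

Lemma eval_bind (sg : signature) (A : algebra sg) (X Y : Type)
    (s : X -> term sg Y) (e : Y -> A) (t : term sg X) :
  eval e (bind s t) = eval (fun x => eval e (s x)) t.
Proof.
elim: t => //= o ts IH; congr interp; exact: functional_extensionality.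
Qed.

Section FreeAlgebra.

Variables (sg : signature) (V : algebra sg -> Prop) (X : Type).
Implicit Types s t : term sg X.

Definition identity_in s t : Prop :=
  forall A : algebra sg, V A -> forall e : X -> A, eval e s = eval e t.

(** The free algebra is the quotient of the terms by the identities of [V].
    Encoding a class as a predicate makes the classes of equivalent terms equal
    by extensionality. *)
Definition free_carrier : Type :=
  {c : term sg X -> Prop | exists t, c = identity_in t}.

Definition class t : free_carrier :=
  exist _ (identity_in t) (ex_intro _ t erefl).

Definition rep (u : free_carrier) : term sg X :=
  proj1_sig (constructive_indefinite_description _ (proj2_sig u)).

Lemma class_eq s t : identity_in s t -> class s = class t.
Proof.
move=> st; apply: subset_eq_compat.
apply: functional_extensionality => r; apply: propositional_extensionality.
by split=> sr A VA e; rewrite -(sr A VA) (st A VA).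
Qed.

Lemma repK u : class (rep u) = u.
Proof.
rewrite /rep; case: constructive_indefinite_description => t /= e.
by case: u e => c p /= e; apply: subset_eq_compat.
Qed.

Lemma identity_rep t : identity_in t (rep (class t)).
Proof.
have : proj1_sig (class (rep (class t))) = proj1_sig (class t) by rewrite repK.
by rewrite /= => <-.
Qed.

Definition free : algebra sg :=
  Algebra (carrier := free_carrier)
    (fun o us => class (App (fun i => rep (us i)))).

Definition gen (x : X) : free := class (Var sg x).

Definition lift (A : algebra sg) (e : X -> A) (u : free) : A := eval e (rep u).

Lemma lift_class (A : algebra sg) (e : X -> A) t :
  V A -> lift e (class t) = eval e t.
Proof. by move=> VA; rewrite /lift -(identity_rep _ VA). Qed.

Lemma lift_gen (A : algebra sg) (e : X -> A) x : V A -> lift e (gen x) = e x.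
Proof. exact: lift_class. Qed.

Lemma lift_interp (A : algebra sg) (e : X -> A) (o : symb sg)
    (us : 'I_(arity o) -> free) :
  V A -> lift e (interp us) = interp (fun i => lift e (us i)).
Proof. exact: lift_class. Qed.

Lemma lift_eval (A : algebra sg) (e : X -> A) (Y : Type) (g : Y -> free)
    (t : term sg Y) :
  V A -> lift e (eval g t) = eval (fun y => lift e (g y)) t.
Proof.
move=> VA; elim: t => //= o ts IH; rewrite (lift_interp e _ VA).
congr interp; exact: functional_extensionality.
Qed.

Lemma eval_class (Y : Type) (s : Y -> term sg X) (t : term sg Y) :
  eval (fun y => class (s y) : free) t = class (bind s t).
Proof.
elim: t => //= o ts IH; apply: class_eq => A VA e /=; congr interp.
by apply: functional_extensionality => i; rewrite IH -(identity_rep _ VA).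
Qed.

Lemma bind_Var t : bind (@Var sg X) t = t.
Proof. by elim: t => //= o ts IH; congr App; apply: functional_extensionality. Qed.

Lemma eval_gen_rep (u : free) : eval gen (rep u) = u.
Proof. by rewrite [LHS]eval_class bind_Var repK. Qed.

(** A valuation in the free algebra is a substitution, and the identities of [V]
    are closed under substitution. *)
Lemma free_in_variety : variety V -> V free.
Proof.
case=> E VE; apply/VE => p q Epq env.
have -> : env = fun i => class (rep (env i)).
  by apply: functional_extensionality => i; rewrite repK.
rewrite !eval_class; apply: class_eq => A VA e; rewrite !eval_bind.
by move/VE: VA; apply.
Qed.

(** When [Q] is the equality of two coordinates, this is the congruence generated
    by identifying the two corresponding generators. *)
Definition agree_on (Q : forall A : algebra sg, (X -> A) -> Prop) :
    relation free :=
  fun u v => forall A : algebra sg, V A -> forall e : X -> A,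
    Q A e -> lift e u = lift e v.

Lemma agree_on_congruence Q : congruence (agree_on Q).
Proof.
split; [split; [split|]|].
- by [].
- move=> o a b ab A VA e Qe; rewrite !lift_interp //; congr interp.
  by apply: functional_extensionality => i; apply: ab.
- by move=> u v uv A VA e Qe; rewrite uv.
- by move=> u v w uv vw A VA e Qe; rewrite uv // vw.
Qed.

End FreeAlgebra.

(** * From relation inclusions to terms and back *)

Lemma tnth4_comp (B C : Type) (g : B -> C) (x y z w : B) i :
  g (tnth [tuple x; y; z; w] i) = tnth [tuple g x; g y; g z; g w] i.
Proof. by case: i => -[|[|[|[|]]]]. Qed.

Section FourAryTerms.

Variables (sg : signature) (A : algebra sg).
Implicit Types x y z u v : A.

(** When [x], [y], [z] generate the algebra, this is the reflexive compatible
    relation generated by the pair [(x, y)]. *)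
Definition pair_translates x y z : relation A :=
  fun u v => exists t : term sg 'I_4, u = app4 t x y z x /\ v = app4 t x y z y.

Lemma pair_translates_compatible x y z : compatible (pair_translates x y z).
Proof.
move=> o a b /fin_all_exists[ts ab]; exists (App ts).
by split; rewrite /app4 /=; congr interp; apply: functional_extensionality => i;
  case: (ab i).
Qed.

(** The term [f_i] is read from [f_i(x, y, z, x)] to [f_i(x, y, z, y)] for even
    [i] and backwards for odd [i], hence the dependence of the [gamma]-links on
    the parity. *)
Definition zigzag_terms (beta gamma : relation A) x y z u : Prop :=
  exists (n : nat) (f : nat -> term sg 'I_4), ~~ odd n /\
    [/\ u = app4 (f 0) x y z x /\ app4 (f n) x y z y = z,
        forall i, i <= n -> beta (app4 (f i) x y z x) (app4 (f i) x y z y),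
        forall i, odd i -> i <= n ->
          gamma (app4 (f i.-1) x y z y) (app4 (f i) x y z y) &
        forall i, ~~ odd i -> 1 <= i <= n ->
          gamma (app4 (f i.-1) x y z x) (app4 (f i) x y z x)].

(** One factor [P ∘ gamma ∘ P⁻ ∘ gamma] supplies two terms, the first read
    forwards and the second backwards, to put in front of the sequence. The
    sequence ends with the projection to [z], at an even index. *)
Lemma zigzag_terms_rpow (beta gamma : relation A) x y z n u :
  let P := pair_translates x y z ∩ beta in
  Reflexive beta ->
  rpow (P ∘ gamma ∘ P⁻ ∘ gamma) n u z -> zigzag_terms beta gamma x y z u.
Proof.
move=> P rb; elim: n u => [u ->|n IHn u [w [uw /IHn]]].
  by exists 0, (fun=> Var sg (inord 2)); split=> //; split=> [|i _|i|i];
    rewrite /app4 /= ?(tnth_nth z) /= ?inordK //; case: i.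
case: uw => v2 [[v1 [[v0 [[[t0 [eu e0]] b0] g0]] [[t1 [e2 e1]] b1]]] g1].
case=> m [f [even_m [[ew ez] fb fo fe]]].
subst u v0 v1 v2 w.
exists m.+2, (fun i => match i with 0 => t0 | 1 => t1 | k.+2 => f k end).
split; first by rewrite /= negbK.
split=> // [[|[|i]]|[|[|[|i]]]|[|[|[|i]]]] //=.
- exact: fb.
- by rewrite !negbK => odd_i le_im; apply: (fo i.+1).
- by rewrite !negbK => odd_i le_im; apply: (fe i.+1); rewrite /= ?negbK.
Qed.

Lemma M_app4 (R S : relation A) (t : term sg 'I_4) a b c a' b' c' d d' :
  R a a' -> R b b' -> R c c' -> S d d' ->
  M R S (app4 t a b c d) (app4 t a b c d') (app4 t a' b' c' d)
    (app4 t a' b' c' d').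
Proof.
move=> Ra Rb Rc Sd.
(* Three variables move between the rows and one between the columns. *)
exists 3, 1, (bind (fun i : 'I_4 => Var sg (split (i : 'I_(3 + 1)))) t).
exists (tnth [tuple a; b; c]), (tnth [tuple a'; b'; c']), (fun=> d), (fun=> d').
have evE p q r s :
    eval (fun j => match j with
                   | inl i => tnth [tuple p; q; r] i
                   | inr _ => s end)
      (bind (fun i : 'I_4 => Var sg (split (i : 'I_(3 + 1)))) t)
    = app4 t p q r s.
  rewrite eval_bind; apply: eval_ext => i /=.
  case: splitP => j ij; rewrite !(tnth_nth p) /= ij.
    by case: j {ij} => -[|[|[|]]].
  by case: j {ij} => -[|].
by split; rewrite /= ?evE //; case=> -[|[|[|]]].
Qed.

End FourAryTerms.

Section FreeThree.

Variables (sg : signature) (V : algebra sg -> Prop).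

Let i0 : 'I_3 := Ordinal (isT : 0 < 3).
Let i1 : 'I_3 := Ordinal (isT : 1 < 3).
Let i2 : 'I_3 := Ordinal (isT : 2 < 3).

(** Every element is a term in the generators, read here as a 4-ary term that
    ignores its last variable. *)
Lemma pair_translates_refl :
  Reflexive (pair_translates (gen V i0) (gen V i1) (gen V i2)).
Proof.
move=> u; exists (bind (fun i : 'I_3 => Var sg (widen_ord (leqnSn 3) i)) (rep u)).
rewrite /app4 !eval_bind -{1 3}[u]eval_gen_rep.
by split; apply: eval_ext => i; rewrite /= (tnth_nth u) /=;
  case: i => -[|[|[|]]] //= lti; congr gen; apply: val_inj.
Qed.

(** The inclusion is needed only in the free algebra on three generators, where
    two term values are related by [beta] or [gamma] exactly when [V] satisfies
    the corresponding identity with two of the variables equated. *)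
Lemma zigzag_terms_exist : variety V ->
  (forall beta gamma T : relation (free V 'I_3),
     congruence beta -> congruence gamma -> refl_compatible T ->
     (beta ∩ (T ∘ gamma)) ⊆ Cg (gamma ∘ (T ∩ beta))) ->
  exists (n : nat) (f : nat -> term sg 'I_4),
    ~~ odd n /\
    forall A : algebra sg, V A -> forall x y z : A,
      [/\ x = app4 (f 0) x y z x /\ app4 (f n) x y z y = z,
          forall i, ~~ odd i -> 0 <= i <= n ->
            app4 (f i) x y x x = app4 (f i) x y x y,
          forall i, odd i -> 1 <= i <= n ->
            app4 (f i.-1) x y y y = app4 (f i) x y y y,
          forall i, odd i -> 0 <= i <= n ->
            app4 (f i) x y x y = app4 (f i) x y x x &
          forall i, ~~ odd i -> 1 <= i <= n ->
            app4 (f i.-1) x y y x = app4 (f i) x y y x].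
Proof.
move=> hV vi; have VF := free_in_variety 'I_3 hV.
pose x0 := gen V i0; pose y0 := gen V i1; pose z0 := gen V i2.
pose beta := @agree_on sg V 'I_3 (fun A e => e i0 = e i2).
pose gamma := @agree_on sg V 'I_3 (fun A e => e i1 = e i2).
have cb : congruence beta by apply: agree_on_congruence.
have cg : congruence gamma by apply: agree_on_congruence.
have rcT : refl_compatible (pair_translates x0 y0 z0).
  split; [exact: pair_translates_refl | exact: pair_translates_compatible].
have rcP : refl_compatible (pair_translates x0 y0 z0 ∩ beta).
  by apply: refl_compatible_meet => //; case: cb => [[]].
have xz : Cg (gamma ∘ (pair_translates x0 y0 z0 ∩ beta)) x0 z0.
  apply: vi => //; split; first by move=> A VA e Qe; rewrite !lift_gen.
  exists y0; split; last by move=> A VA e Qe; rewrite !lift_gen.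
  exists (Var sg ord_max); split; by rewrite /app4 /= (tnth_nth x0).
have [n /zigzag_terms_rpow] := Cg_rcomp_zigzag rcP cg xz.
case=> [|m [f [even_m [[ex ez] fb fo fe]]]]; first by case: cb => [[[]]].
exists m, f; split=> // A VA.
(* Each pair in [beta] or [gamma] gives an identity in [A] through the
   homomorphism that sends the generators to suitable [x], [y], [z]. *)
pose ev x y z : free V 'I_3 -> A := lift (tnth [tuple x; y; z]).
have evE x y z t u v w s :
    ev x y z (app4 t u v w s) =
    app4 t (ev x y z u) (ev x y z v) (ev x y z w) (ev x y z s).
  rewrite /app4 [LHS](lift_eval _ _ _ VA); apply: eval_ext => i.
  exact: (tnth4_comp (ev x y z)).
have evx x y z : ev x y z x0 = x by apply: lift_gen.
have evy x y z : ev x y z y0 = y by apply: lift_gen.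
have evz x y z : ev x y z z0 = z by apply: lift_gen.
have {}evE := (evE, evx, evy, evz).
have bE i (x y : A) : i <= m -> app4 (f i) x y x x = app4 (f i) x y x y.
  by move=> /fb /(_ A VA (tnth [tuple x; y; x]) erefl); rewrite -/(ev _ _ _) !evE.
move=> x y z; split.
- split; last by rewrite -{2}(evz x y z) -ez !evE.
  by rewrite -{1}(evx x y z) ex !evE.
- by move=> i _ /andP[_ /bE].
- move=> i odd_i /andP[_ le_im].
  by have := fo i odd_i le_im A VA (tnth [tuple x; y; y]) erefl; rewrite -/(ev _ _ _) !evE.
- by move=> i _ /andP[_ /bE].
- move=> i even_i le_im.
  by have := fe i even_i le_im A VA (tnth [tuple x; y; y]) erefl; rewrite -/(ev _ _ _) !evE.
Qed.

End FreeThree.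

(** The matrix of [f_i] that moves its third variable between the rows and its
    fourth between the columns, both from [a] to [b], has a constant first row;
    so [f_i(a, b, b, a)] and [f_i(a, b, b, b)] are congruent. The other
    identities glue these pairs into a chain from [a] to [b]. *)
Lemma zigzag_terms_neutral (sg : signature) (A : algebra sg) (R : relation A)
    (n : nat) (f : nat -> term sg 'I_4) (a b : A) :
  refl_compatible R -> R a b -> ~~ odd n ->
  a = app4 (f 0) a b b a -> app4 (f n) a b b b = b ->
  (forall i, i <= n -> app4 (f i) a b a a = app4 (f i) a b a b) ->
  (forall i, odd i -> i <= n -> app4 (f i.-1) a b b b = app4 (f i) a b b b) ->
  (forall i, ~~ odd i -> 1 <= i <= n ->
     app4 (f i.-1) a b b a = app4 (f i) a b b a) ->
  Cg (comm1 R R) a b.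
Proof.
move=> [rR cR] Rab even_n ea eb fxyx fo fe.
have [[[rC _] sC] tC] := Cg_congruence (comm1 R R).
have row i : i <= n ->
    Cg (comm1 R R) (app4 (f i) a b b a) (app4 (f i) a b b b).
  move=> le_in; apply: Cg_sub; apply: t_step; exists (app4 (f i) a b a a).
  by rewrite {2}fxyx //; apply: M_app4.
suff chain i : i <= n -> Cg (comm1 R R) a (app4 (f i) a b b a).
  by rewrite -{1}eb; exact: (tC _ _ _ (chain n (leqnn n)) (row n (leqnn n))).
elim: i => [_|i IHi lt_in]; first by rewrite -ea; apply: rC.
have chain := IHi (ltnW lt_in).
have [odd_i|even_i] := boolP (odd i.+1); last by rewrite -(fe i.+1) ?lt_in.
apply: (tC _ _ _ chain); apply: (tC _ _ _ (row i (ltnW lt_in))).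
rewrite (fo i.+1) //; by apply: sC; apply: row.
Qed.

Theorem theorem5 (sg : signature) (V : algebra sg -> Prop) (hV : variety V) :
  [<->
    (* (i) *)
    forall A : algebra sg, V A -> forall R : relation A,
      refl_compatible R -> R ⊆ Cg (comm1 R R);
    (* (ia) *)
    forall A : algebra sg, V A -> forall R : relation A,
      refl_compatible R -> R^* ⊆ Cg (comm1 R R);
    (* (ii) *)
    forall A : algebra sg, V A -> forall R T : relation A,
      refl_compatible R -> refl_compatible T -> (R ∩ T) ⊆ Cg (comm1 R T);
    (* (iii) *)
    forall A : algebra sg, V A -> forall R1 R2 T : relation A,
      refl_compatible R1 -> refl_compatible R2 -> refl_compatible T ->
      ((R1 ∘ R2) ∩ T) ⊆ Cg (T ∩ (R2⁻ ∘ (T ∩ (R1⁻ ∘ R1)) ∘ R2));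
    (* (iv) *)
    forall A : algebra sg, V A -> forall R1 R2 T : relation A,
      refl_compatible R1 -> refl_compatible R2 -> refl_compatible T ->
      (R1 ∩ (T ∘ R2)) ⊆ (Cg (T ∩ (R2 ∘ (T ∩ (R1⁻ ∘ R1)) ∘ R2⁻)) ∘ R2);
    (* (v) *)
    forall A : algebra sg, V A -> forall beta S T : relation A,
      congruence beta -> tolerance S -> refl_compatible T ->
      (beta ∩ (T ∘ S)) ⊆ (Cg (T ∩ (S ∘ (T ∩ beta) ∘ S)) ∘ S);
    (* (vi) *)
    forall A : algebra sg, V A -> forall beta gamma T : relation A,
      congruence beta -> congruence gamma -> refl_compatible T ->
      (beta ∩ (T ∘ gamma)) ⊆ Cg (gamma ∘ (T ∩ beta));
    (* (vii)' *)
    exists (n : nat) (f : nat -> term sg 'I_4),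
      ~~ odd n /\
      forall A : algebra sg, V A -> forall x y z : A,
        [/\ x = app4 (f 0) x y z x /\ app4 (f n) x y z y = z,
            forall i, ~~ odd i -> 0 <= i <= n ->
              app4 (f i) x y x x = app4 (f i) x y x y,
            forall i, odd i -> 1 <= i <= n ->
              app4 (f i.-1) x y y y = app4 (f i) x y y y,
            forall i, odd i -> 0 <= i <= n ->
              app4 (f i) x y x y = app4 (f i) x y x x &
            forall i, ~~ odd i -> 1 <= i <= n ->
              app4 (f i.-1) x y y x = app4 (f i) x y y x];
    (* (viii) *)
    forall n : nat, 2 <= n ->
      forall A : algebra sg, V A ->
      forall (Rs : nat -> relation A) (T : relation A),
        (forall i, 1 <= i <= n -> refl_compatible (Rs i)) ->
        refl_compatible T ->
        ((\big[@rcomp A/eq]_(1 <= i < n.+1) Rs i) ∩ T) ⊆ Cg (D Rs T n)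
  ].
Proof.
match goal with
|- all_iff ?P0 (?P0a :: ?P2 :: ?P3 :: ?P4 :: ?P5 :: ?P6 :: ?P7 :: ?P8 :: _) =>
  set Pi := P0; set Pia := P0a; set Pii := P2; set Piii := P3;
  set Piv := P4; set Pv := P5; set Pvi := P6; set Pvii := P7; set Pviii := P8 end.
have i_ia : Pi -> Pia.
  move=> i A VA R rcR; apply: clos_trans_min; last exact: i.
  by case: (Cg_congruence (comm1 R R)).
have ia_ii : Pia -> Pii.
  move=> ia A VA R T rcR rcT x y RTxy.
  have rcRT : refl_compatible (R ∩ T) by apply: refl_compatible_meet.
  have := ia A VA _ rcRT x y (t_step _ _ _ _ RTxy).
  by apply: Cg_mono; apply: comm1_mono => u v [].
have ii_viii : Pii -> Pviii.
  move=> ii [//|n] _ A VA Rs T rcRs rcT x y RTxy.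
  apply: Cg_min (comm1_big_Cg_D rcRs rcT) _ _ _; first exact: Cg_congruence.
  by apply: ii RTxy => //; apply: refl_compatible_big.
have viii_iii : Pviii -> Piii.
  move=> viii A VA R1 R2 T rc1 rc2 rcT.
  have := viii 2 isT A VA (fun i => if i == 1 then R1 else R2) T.
  by rewrite big_nat_recr // big_nat1; apply=> // i _; case: ifP.
have vii_i : Pvii -> Pi.
  case=> n [f [even_n ft]] A VA R rcR a b Rab.
  have [[ea eb] _ fo _ fe] := ft A VA a b b.
  have [_ fxyx_even _ fxyx_odd _] := ft A VA a b a.
  apply: (@zigzag_terms_neutral _ A R n f) => // [i le_in|i odd_i le_in].
    have [/fxyx_odd|/fxyx_even] := boolP (odd i); last exact.
    by move=> /(_ le_in).
  by apply: fo; rewrite ?odd_gt0.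
have iii_iv : Piii -> Piv.
  move=> iii A VA R1 R2 T rc1 rc2 rcT x y [R1xy [z [Txz R2zy]]].
  exists z; split=> //.
  apply: (iii A VA R1 (R2⁻) T) => //; first exact: refl_compatible_transp.
  by split=> //; exists y.
have iv_v : Piv -> Pv.
  move=> iv A VA beta S T [[rcb sb] tb] [rcS sS] rcT x y xy.
  have [z [xz Szy]] := iv A VA beta S T rcb rcS rcT x y xy.
  exists z; split=> //.
  apply: Cg_mono xz => u v [Tuv [q [[p [Sup [Tpq bpq]]] Svq]]].
  split=> //; exists q; split; last exact: sS.
  exists p; split=> //; split=> //; case: bpq => r [brp brq].
  by apply: tb brq; apply: sb.
have v_vi : Pv -> Pvi.
  move=> v A VA beta gamma T cb cg rcT x y xy.
  have [[[rb _] _] _] := cb; have [tolg _] := cg; have [[rg _] sg_] := tolg.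
  have [rT _] := rcT.
  have [[_ _] tC] := Cg_congruence (gamma ∘ (T ∩ beta)).
  have gC : gamma ⊆ Cg (gamma ∘ (T ∩ beta)).
    by move=> u w guw; apply: Cg_sub; exists w.
  have [z [xz gzy]] := v A VA beta gamma T cb tolg rcT x y xy.
  apply: (fun H => tC _ _ _ H (gC _ _ gzy)); apply: Cg_min xz; first exact: Cg_congruence.
  move=> u w [_ [q [uq gqw]]]; apply: (fun H => tC _ _ _ H (gC _ _ gqw)); exact: Cg_sub.
have vi_vii : Pvi -> Pvii.
  by move=> vi; apply: zigzag_terms_exist => //; apply: vi; apply: free_in_variety.
tfae=> //; first by move=> /ii_viii/viii_iii.
  by move=> /vii_i/i_ia/ia_ii/ii_viii.
by move=> /viii_iii/iii_iv/iv_v/v_vi/vi_vii/vii_i.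
Qed.
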